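(* For any hypergraph $H$, the rank of $B_H$ and the rank of $B_{H/\mathcal{R}_u(H)}$ are the same, where $H/\mathcal{R}_u(H)$ is the unit-contraction of $H$.
   Context: A hypergraph $H$ is a pair $(V(H),E(H))$ with $V(H)$ a non-empty finite set (vertices) and $E(H)$ a set of non-empty subsets of $V(H)$ (hyperedges). The edge-vertex incidence matrix $B_H=[b_{ev}]_{e\in E(H),v\in V(H)}$ (over $\mathbb{C}$) has $b_{ev}=1$ if $v\in e$ and $b_{ev}=0$ otherwise. The star of a vertex $v$ is $E_v(H)=\{e\in E(H): v\in e\}$. A unit in $H$ is an equivalence class of the equivalence relation $\mathcal{R}_u(H)=\{(u,v)\in V(H)\times V(H): E_u(H)=E_v(H)\}$; the unit containing $v$ is denoted $W_{E_v(H)}$, and $\mathfrak{U}(H)$ is the set of all units. The unit-contraction $H/\mathcal{R}_u(H)$ is the hypergraph with vertex set $\mathfrak{U}(H)$ and hyperedge set $\{\tilde e : e\in E(H)\}$, where $\tilde e=\{W_{E_v(H)}: v\in e\}$ (a set, without repetitions). *)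

(* Defs.v *)
From HB Require Import structures.
From mathcomp Require Import all_boot all_order all_algebra.
From mathcomp Require Import reals.
From mathcomp Require Import complex.

Set Implicit Arguments.
Unset Strict Implicit.
Unset Printing Implicit Defensive.

Import GRing.Theory.

(* The vertex set is a finite set inside an ambient finite type, so that the
   vertices of a contraction can be sets of vertices. *)
Record hypergraph (T : finType) := Hypergraph {
  vertices : {set T};
  hyperedges : {set {set T}};
  vertices_neq0 : vertices != set0;
  hyperedges_neq0 : forall e, e \in hyperedges -> e != set0;
  hyperedges_sub : forall e, e \in hyperedges -> e \subset vertices
}.

(* Rows and columns follow the fixed enumerations of the hyperedges and of the
   vertices given by enum_val. *)
Definition incidence_mx (K : nzRingType) (T : finType) (H : hypergraph T) :
    'M[K]_(#|hyperedges H|, #|vertices H|) :=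
  \matrix_(i, j) (if enum_val j \in (enum_val i : {set T}) then 1 else 0)%R.

Section UnitContraction.
Variables (T : finType) (H : hypergraph T).

Definition star (v : T) : {set {set T}} := [set e in hyperedges H | v \in e].

Definition unit_rel : rel T := [rel u v | star u == star v].

Definition unit_of (v : T) : {set T} := [set u in vertices H | unit_rel v u].

Definition units : {set {set T}} := equivalence_partition unit_rel (vertices H).

Definition contract_edge (e : {set T}) : {set {set T}} :=
  [set unit_of v | v in e].

Definition contract_edges : {set {set {set T}}} :=
  [set contract_edge e | e in hyperedges H].

Lemma units_neq0 : units != set0.
Proof.
have [v vV] := set0Pn _ (vertices_neq0 H).
by apply/set0Pn; exists (unit_of v); apply: imset_f.
Qed.

Lemma contract_edges_neq0 e' : e' \in contract_edges -> e' != set0.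
Proof.
case/imsetP=> e eE ->; have [v ve] := set0Pn _ (hyperedges_neq0 eE).
by apply/set0Pn; exists (unit_of v); apply: imset_f.
Qed.

Lemma contract_edges_sub e' : e' \in contract_edges -> e' \subset units.
Proof.
case/imsetP=> e eE ->; apply/subsetP=> _ /imsetP[v ve ->].
by apply: imset_f; apply: (subsetP (hyperedges_sub eE)).
Qed.

Definition unit_contraction : hypergraph {set T} :=
  Hypergraph units_neq0 contract_edges_neq0 contract_edges_sub.

End UnitContraction.

(* Main.v *)
Require Import Defs.
From mathcomp Require Import all_boot all_order all_algebra.
From mathcomp Require Import reals.
From mathcomp Require Import complex.

(** Contracting the units merges vertices with the same star, that is, equal
    columns of the incidence matrix.  The edges are pulled back faithfully: a
    vertex lies in an edge exactly when its unit lies in the contracted edge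
    ([mem_contract_edge]), because an edge containing one vertex of a unit
    contains all of them.  Hence the incidence matrix of the hypergraph is that
    of the contraction with rows and columns re-indexed along surjections
    (edge to contracted edge, vertex to unit), which can at most repeat rows and
    columns, and so preserves the rank ([mxrank_mxsub_surj]). *)

Lemma mxrank_mxsub_le (F : fieldType) (m n m' n' : nat) (f : 'I_m' -> 'I_m)
    (g : 'I_n' -> 'I_n) (A : 'M[F]_(m, n)) :
  \rank (mxsub f g A) <= \rank A.
Proof.
rewrite mxsubrc; apply: leq_trans (mxrankS (rowsub_sub _ _)) _.
by rewrite -mxrank_tr trmx_mxsub -(mxrank_tr A) mxrankS // rowsub_sub.
Qed.

(** Sections of the two surjections exhibit [A] as a re-indexing of
    [mxsub f g A], so that the rank cannot drop. *)
Lemma mxrank_mxsub_surj (F : fieldType) (m n m' n' : nat) (f : 'I_m' -> 'I_m)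
    (g : 'I_n' -> 'I_n) (A : 'M[F]_(m, n)) :
    (forall i, exists i', f i' = i) -> (forall j, exists j', g j' = j) ->
  \rank (mxsub f g A) = \rank A.
Proof.
move=> /fin_all_exists[f' f'K] /fin_all_exists[g' g'K].
apply/eqP; rewrite eqn_leq mxrank_mxsub_le.
have {1}-> : A = mxsub f' g' (mxsub f g A).
  by apply/matrixP=> i j; rewrite !mxE f'K g'K.
exact: mxrank_mxsub_le.
Qed.

(** If [v] lies in the unit of some [w] in [e], then [v] and [w] have the same
    star, to which [e] belongs. *)
Lemma mem_contract_edge (T : finType) (H : hypergraph T) (e : {set T}) (v : T) :
    e \in hyperedges H -> v \in vertices H ->
  (unit_of H v \in contract_edge H e) = (v \in e).
Proof.
move=> eH vH; apply/imsetP/idP=> [[w we unit_vw]|]; last by exists v.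
have: v \in unit_of H w by rewrite -unit_vw inE vH /unit_rel /=.
rewrite inE => /andP[_ /eqP star_wv].
have: e \in star H w by rewrite inE eH.
by rewrite star_wv inE => /andP[].
Qed.

Theorem corollary2p29 (R : realType) (T : finType) (H : hypergraph T) :
  \rank (incidence_mx R[i]%C H) = \rank (incidence_mx R[i]%C (unit_contraction H)).
Proof.
have edge_in (i : 'I_#|hyperedges H|) :
    contract_edge H (enum_val i) \in hyperedges (unit_contraction H).
  by apply: imset_f; apply: enum_valP.
have unit_in (j : 'I_#|vertices H|) :
    unit_of H (enum_val j) \in vertices (unit_contraction H).
  by apply: (imset_f (unit_of H)); exact: enum_valP.
pose f i := enum_rank_in (edge_in i) (contract_edge H (enum_val i)).
pose g j := enum_rank_in (unit_in j) (unit_of H (enum_val j)).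
have fE i : enum_val (f i) = contract_edge H (enum_val i).
  exact: enum_rankK_in (edge_in i).
have gE j : enum_val (g j) = unit_of H (enum_val j).
  exact: enum_rankK_in (unit_in j).
have -> : incidence_mx R[i]%C H
          = mxsub f g (incidence_mx R[i]%C (unit_contraction H)).
  apply/matrixP=> i j; rewrite !mxE fE gE mem_contract_edge //;
  exact: enum_valP.
apply: mxrank_mxsub_surj => [i | j].
  have /imsetP[e eH iE] := enum_valP i.
  exists (enum_rank_in eH e); apply: enum_val_inj.
  by rewrite fE iE enum_rankK_in.
have /imsetP[v vH jE] := enum_valP j.
exists (enum_rank_in vH v); apply: enum_val_inj.
by rewrite gE jE enum_rankK_in.
Qed.
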